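(* Let $\mathbf A$ be a finite $\mathbf R_A$-module and let $\mathbf B$ be a finite $\mathbf R_B$-module. Assume that the full clonoid $\mathcal O_{A,B}$ is generated by the $m$-ary functions, for some $m$, i.e. $\mathcal O_{A,B}=\langle\mathcal O_{A,B}^{(m)}\rangle_{\mathbf A,\mathbf B}$. Then $m\ge\frac{\log|A|}{\log|R_A|}$.
   Context: $\mathbb N=\{1,2,\dots\}$. Rings are unital, modules are left modules; $R_A$ denotes the underlying set of the ring $\mathbf R_A$. For sets $A,B$, $\mathcal O_{A,B}=\bigcup_{n\in\mathbb N}B^{A^n}$ is the set of all finitary operations from $A$ to $B$, and for $\mathcal C\subseteq\mathcal O_{A,B}$, $\mathcal C^{(n)}=\mathcal C\cap B^{A^n}$. A module over a ring $\mathbf S$ is viewed as an algebra $(A,+,0,-,(s)_{s\in S})$; its $n$-ary term operations are the maps $\sum_{i=1}^ns_ix_i$ with $s_i\in S$. A clonoid from an algebra $\mathbf A$ to an algebra $\mathbf B$ is a set $\mathcal C\subseteq\mathcal O_{A,B}$ such that for all $k,n\in\mathbb N$: (i) if $f_1,\dots,f_n\in\mathcal C^{(k)}$ and $g$ is an $n$-ary term operation of $\mathbf B$, then $g\circ(f_1,\dots,f_n)\in\mathcal C^{(k)}$; (ii) if $f\in\mathcal C^{(k)}$ and $g_1,\dots,g_k$ are $n$-ary term operations of $\mathbf A$, then $f\circ(g_1,\dots,g_k)\in\mathcal C^{(n)}$. For $G\subseteq\mathcal O_{A,B}$, $\langle G\rangle_{\mathbf A,\mathbf B}$ is the smallest clonoid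 from $\mathbf A$ to $\mathbf B$ containing $G$.
   Formalization: The module B is additionally assumed to be nonzero; for B = 0 the statement fails (e.g. A = F_2^2 over R_A = F_2 with m = 1). For infinite R_A, or R_A the zero ring, the quotient is read as 0. *)

(* Defs.v *)
From HB Require Import structures.
From mathcomp Require Import all_boot all_order all_algebra.
From mathcomp Require Import all_classical all_reals all_analysis.

Set Implicit Arguments.
Unset Strict Implicit.
Unset Printing Implicit Defensive.

Import Order.TTheory GRing.Theory Num.Theory.
Local Open Scope classical_set_scope.
Local Open Scope ring_scope.

Definition operation (A B : Type) : Type := {n : nat & ('I_n -> A) -> B}.

Definition Op (A B : Type) (n : nat) (f : ('I_n -> A) -> B) : operation A B :=
  existT (fun k : nat => ('I_k -> A) -> B) n f.

(* Arities start at 1, so the nullary elements of [operation A B] are left out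
   of O_{A,B}. *)
Definition all_ops (A B : Type) : set (operation A B) :=
  [set f | (0 < projT1 f)%N].

Definition arity_part (A B : Type) (C : set (operation A B)) (n : nat) :
    set (operation A B) :=
  [set f | C f /\ projT1 f = n].

Definition term_op (S : pzRingType) (M : lmodType S) (n : nat) :
    set (('I_n -> M) -> M) :=
  [set g | exists s : 'I_n -> S, g = fun x => \sum_(i < n) s i *: x i].

Definition is_clonoid (RA RB : pzRingType) (A : lmodType RA) (B : lmodType RB)
    (C : set (operation A B)) : Prop :=
  [/\ C `<=` @all_ops A B,
      forall (k n : nat) (f : 'I_n -> ('I_k -> A) -> B) (g : ('I_n -> B) -> B),
        (0 < k)%N -> (0 < n)%N ->
        (forall i, C (Op (f i))) -> @term_op RB B n g ->
        C (Op (fun x : 'I_k -> A => g (fun i => f i x)))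
    & forall (k n : nat) (f : ('I_k -> A) -> B) (g : 'I_k -> ('I_n -> A) -> A),
        (0 < k)%N -> (0 < n)%N ->
        C (Op f) -> (forall i, @term_op RA A n (g i)) ->
        C (Op (fun x : 'I_n -> A => f (fun i => g i x)))].

Definition clonoid_gen (RA RB : pzRingType) (A : lmodType RA)
    (B : lmodType RB) (G : set (operation A B)) : set (operation A B) :=
  smallest (@is_clonoid RA RB A B) G.

(* The cardinality of a possibly infinite type, +oo when it is infinite. *)
Definition ecard (R : realType) (T : choiceType) : \bar R :=
  @counting T R [set: T].

(* Main.v *)
Require Import Defs.
From HB Require Import structures.
From mathcomp Require Import all_boot all_order all_algebra.
From mathcomp Require Import finmap.
From mathcomp Require Import all_classical all_reals all_analysis.

Import Order.TTheory GRing.Theory Num.Theory.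
Local Open Scope classical_set_scope.
Local Open Scope ring_scope.

(** If [RA] is finite, the operations of the form
    [x |-> \sum_M phi_M (M x)], with [M] ranging over the [m x n] matrices over
    [RA] and [phi_M : A^m -> B] arbitrary, form a clonoid containing the [m]-ary
    operations.  If the latter generate everything, then counting the [n]-ary
    operations gives [|B|^(|A|^n) <= |B|^(|A|^m * |RA|^(m n))], that is
    [|A|^n <= |A|^m * (|RA|^m)^n] since [B] is nontrivial.  Letting [n] grow
    yields [|A| <= |RA|^m]. *)

Lemma finite_set_finType (T : choiceType) : finite_set [set: T] ->
  exists (F : finType) (e : F -> T) (d : T -> F),
    [/\ cancel e d, cancel d e
      & forall R : realType, ecard R T = #|F|%:R%:E].
Proof.
move=> finT; have inF x : x \in fset_set [set: T] by rewrite in_fset_set ?inE.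
exists (fset_set [set: T]), val, (fun x => [` inF x]%fset); split => //.
- by move=> x; exact: val_inj.
- by move=> R; rewrite /ecard /counting asboolT // cardfE.
Qed.

(** If [a > q], then [(a / q) ^ n] is at least [1 + n / q] by Bernoulli, so it outgrows the constant
    [c]. *)
Lemma leq_of_expn_bound (a q c : nat) : (0 < q)%N ->
  (forall n, (0 < n)%N -> a ^ n <= c * q ^ n)%N -> (a <= q)%N.
Proof.
move=> q0 bnd; rewrite leqNgt; apply/negP => qa.
(* Bernoulli's inequality for [1 + 1 / q], cleared of denominators. *)
have bernoulli n : (q ^ n * (q + n) <= a ^ n * q)%N.
  elim: n => [|n IHn]; first by rewrite !expn0 addn0.
  rewrite !expnS -!mulnA.
  apply: (@leq_trans (q.+1 * (q ^ n * (q + n)))); last exact: leq_mul.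
  rewrite !(mulnCA _ (q ^ n)%N) leq_mul2l addnS mulSn mulnS.
  by rewrite leq_add2r leq_addr orbT.
(* This exponent is large enough that [q + n > c * q]. *)
have /(_ isT) bn := bnd (c * q).+1; have := bernoulli (c * q).+1.
rewrite leqNgt => /negP; apply.
apply: (@leq_ltn_trans (c * q ^ (c * q).+1 * q)); first by rewrite leq_mul2r bn orbT.
rewrite mulnAC mulnC ltn_mul2l expn_gt0 q0 /=.
by rewrite addnS ltnS leq_addl.
Qed.

(** Entries are codes in [F], decoded by [e], so that the matrices form a finite type that can be
    summed over and counted. *)
Definition mx_apply {RA : pzRingType} {A : lmodType RA} {F : finType}
    (e : F -> RA) {m n : nat} (M : {ffun 'I_m -> {ffun 'I_n -> F}})
    (x : 'I_n -> A) : 'I_m -> A :=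
  fun i => \sum_(j < n) e (M i j) *: x j.

Definition mx_sums {RA RB : pzRingType} (A : lmodType RA) (B : lmodType RB)
    {F : finType} (e : F -> RA) (m : nat) : set (operation A B) :=
  [set f : operation A B | (0 < projT1 f)%N /\
    exists phi : {ffun 'I_m -> {ffun 'I_(projT1 f) -> F}} -> ('I_m -> A) -> B,
      forall x, projT2 f x = \sum_M phi M (mx_apply e M x)].

(** Outer coefficients are absorbed into [phi]. An inner substitution with coefficient matrix [s]
    turns [M] into the product [M s], which is again an [m]-row matrix. *)
Lemma mx_sums_clonoid (RA RB : pzRingType) (A : lmodType RA) (B : lmodType RB)
    (F : finType) (e : F -> RA) (d : RA -> F) (m : nat) :
  cancel d e -> is_clonoid (mx_sums A B e m).
Proof.
move=> dK; split.
- by move=> f [].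
- move=> k n f g k0 n0 Cf [s ->]; split => //=.
  have {}Cf i : exists phi : {ffun 'I_m -> {ffun 'I_k -> F}} -> ('I_m -> A) -> B,
      forall x, f i x = \sum_M phi M (mx_apply e M x).
    by case: (Cf i).
  have [phi phiE] := choice Cf.
  exists (fun M y => \sum_(i < n) s i *: phi i M y) => x.
  rewrite exchange_big /=; apply: eq_bigr => i _.
  by rewrite phiE scaler_sumr.
- move=> k n f g k0 n0 [_ [/= phi phiE]] Cg; split => //=.
  have [s sE] := choice Cg.
  (* [MN M] encodes [M s]. Different [M] may give the same product, so the new [phi] sums the old
     one over each fibre of [MN]. *)
  pose MN (M : {ffun 'I_m -> {ffun 'I_k -> F}}) : {ffun 'I_m -> {ffun 'I_n -> F}} :=
    [ffun i => [ffun j => d (\sum_(l < k) e (M i l) * s l j)]].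
  exists (fun M' y => \sum_(M | MN M == M') phi M y) => x.
  rewrite phiE (partition_big MN xpredT) //=.
  apply: eq_bigr => M' _; apply: eq_bigr => M /eqP <-.
  congr (phi M _); apply/funext => i; rewrite /mx_apply.
  under eq_bigr => l _ do rewrite sE scaler_sumr.
  rewrite exchange_big /=; apply: eq_bigr => j _.
  rewrite !ffunE dK scaler_suml; apply: eq_bigr => l _.
  by rewrite scalerA.
Qed.

Lemma arity_part_mx_sums (RA RB : pzRingType) (A : lmodType RA)
    (B : lmodType RB) (F : finType) (e : F -> RA) (d : RA -> F) (m : nat) :
  cancel d e ->
  arity_part (@all_ops A B) m `<=` mx_sums A B e m.
Proof.
move=> dK [n f] [/= n0 nm]; rewrite -{m}nm; split => //=.
(* The identity matrix, which carries the only nonzero summand. *)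
pose I1 : {ffun 'I_n -> {ffun 'I_n -> F}} := [ffun i => [ffun j => d (i == j)%:R]].
exists (fun M y => if M == I1 then f y else 0) => x.
rewrite (bigD1 I1) //= eqxx big1 ?addr0; last by move=> M /negPf ->.
congr (f _); apply/funext => i; rewrite /mx_apply (bigD1 i) //= big1.
  by rewrite !ffunE dK eqxx scale1r addr0.
by move=> j /negPf ji; rewrite !ffunE dK eq_sym ji scale0r.
Qed.

(** The families [phi] map onto the [n]-ary operations. Comparing the two cardinalities, both powers
    of [#|FB| > 1], compares their exponents. *)
Lemma card_generated_leq (RA RB : pzRingType) (A : lmodType RA)
    (B : lmodType RB) (F FA FB : finType) (e : F -> RA) (d : RA -> F)
    (eA : FA -> A) (dA : A -> FA) (eB : FB -> B) (dB : B -> FB) (m n : nat) :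
  cancel d e -> cancel eA dA -> cancel dA eA -> cancel eB dB -> cancel dB eB ->
  (1 < #|FB|)%N -> (0 < n)%N ->
  @all_ops A B = @clonoid_gen RA RB A B (arity_part (@all_ops A B) m) ->
  (#|FA| ^ n <= #|FA| ^ m * (#|F| ^ m) ^ n)%N.
Proof.
move=> dK eAK dAK eBK dBK FB1 n0 gen.
pose build (phi : {ffun {ffun 'I_m -> {ffun 'I_n -> F}} ->
                        {ffun {ffun 'I_m -> FA} -> FB}}) :
    {ffun {ffun 'I_n -> FA} -> FB} :=
  [ffun x : {ffun 'I_n -> FA} => dB (\sum_M eB (phi M
     [ffun i => dA (mx_apply e M (fun j => eA (x j)) i)]))].
have build_onto h : exists phi, h = build phi.
  pose f (x : 'I_n -> A) : B := eB (h [ffun j => dA (x j)]).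
  have : @clonoid_gen RA RB A B (arity_part (@all_ops A B) m) (Op f).
    by rewrite -gen.
  (* The generated clonoid lies in every clonoid containing the generators. *)
  move/(_ (mx_sums A B e m)) => -[|_ [/= phi phiE]].
    by split; [exact: mx_sums_clonoid dK | exact: arity_part_mx_sums dK].
  exists [ffun M => [ffun y : {ffun 'I_m -> FA} => dB (phi M (fun i => eA (y i)))]].
  apply/ffunP => x; rewrite ffunE.
  under eq_bigr => M _.
    rewrite !ffunE dBK.
    under [X in phi M X]eq_fun => i do rewrite ffunE dAK.
    over.
  rewrite -phiE /f eBK; congr (h _); apply/ffunP => j.
  by rewrite ffunE eAK.
(* A section of the surjection [build] is injective. *)
have [sec secK] := choice build_onto.
have := @leq_card _ _ sec (can_inj (g := build) (fun h => esym (secK h))).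
rewrite !card_ffun !card_ord -!expnM leq_exp2l //.
by rewrite (mulnC n m).
Qed.

Theorem theorem58 (R : realType) (RA RB : pzRingType)
    (A : lmodType RA) (B : lmodType RB)
    (finA : finite_set [set: A]) (finB : finite_set [set: B])
    (ntB : exists b : B, b != 0)
    (m : nat) (m_gt0 : (0 < m)%N)
    (gen : @all_ops A B =
           @clonoid_gen RA RB A B (@arity_part A B (@all_ops A B) m)) :
  (lne (ecard R A) / lne (ecard R RA) <= m%:R%:E)%E.
Proof.
have [FA [eA [dA [eAK dAK cardA]]]] := finite_set_finType _ finA.
have FA0 : (0 < #|FA|)%N by apply/card_gt0P; exists (dA 0).
rewrite cardA lne_EFin ?ltr0n //.
have [finRA|infRA] := pselect (finite_set [set: RA]); last first.
  (* For infinite [RA] the denominator is [+oo], whose inverse is 0, so the quotient is 0. *)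
  by rewrite /ecard /counting asboolF //= invey mule0 lee_fin.
have [FB [eB [dB [eBK dBK _]]]] := finite_set_finType _ finB.
have [F [e [d [eK dK cardF]]]] := finite_set_finType _ finRA.
have F0 : (0 < #|F|)%N by apply/card_gt0P; exists (d 0).
have FB1 : (1 < #|FB|)%N.
  have [b b0] := ntB; apply/card_gt1P; exists (dB b), (dB 0); split => //.
  by rewrite (can_eq dBK).
have leAF : (#|FA| <= #|F| ^ m)%N.
  apply: (@leq_of_expn_bound _ _ (#|FA| ^ m)); first by rewrite expn_gt0 F0.
  move=> n n0.
  exact: (@card_generated_leq RA RB A B F FA FB e d eA dA eB dB).
rewrite cardF lne_EFin ?ltr0n //.
(* When [RA] is trivial the denominator is [ln 1 = 0]. Then [A] is trivial too, and the zero
   numerator makes the quotient 0. *)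
have [F1|F1] := leqP #|F| 1.
  have FA1 : #|FA| = 1%N.
    apply/eqP; rewrite eqn_leq FA0 andbT (leq_trans leAF) //.
    by rewrite -[leqRHS](exp1n m) leq_exp2r.
  by rewrite FA1 ln1 mul0e lee_fin.
have lnF : 0 < ln (#|F|%:R : R) by rewrite ln_gt0 // ltr1n.
rewrite inver gt_eqF // lee_pdivrMr // -EFinM lee_fin mulr_natl -lnXn ?ltr0n //.
by rewrite ler_ln ?qualifE /= ?exprn_gt0 ?ltr0n // -natrX ler_nat.
Qed.
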